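(* Let $c=1/\sqrt{3}$, $d\in\mathbb{R}$, $a(n)=\lfloor cn+d\rfloor$ for $n\in\mathbb{Z}$, and $f(n)=a(n)+a(n-1)+a(n-2)$. Then $a(a(f(n)))=a(n)$ for all integers $n\ge 3$ if and only if \[ d\in I_3=\Bigl[\frac{\sqrt{3}+3}{6},\ \frac{5\sqrt{3}-3}{6}\Bigr]. \] The interval $I_3$ is centred at $\sqrt{3}/2$ with half-width $(2\sqrt{3}-3)/6$, and both endpoints lie in $\mathbb{Q}(\sqrt{3})$. *)

(* Defs.v *)
From HB Require Import structures.
From mathcomp Require Import all_boot all_order all_algebra.
From mathcomp Require Import reals.
Set Implicit Arguments.
Unset Strict Implicit.
Unset Printing Implicit Defensive.
Import Order.TTheory GRing.Theory Num.Theory.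
Local Open Scope ring_scope.

Definition c (R : realType) : R := 1 / Num.sqrt 3.

Definition a (R : realType) (d : R) (n : int) : int :=
  Num.floor (c R * n%:~R + d).

Definition f (R : realType) (d : R) (n : int) : int :=
  a d n + a d (n - 1) + a d (n - 2).

Definition I3_left (R : realType) : R := (Num.sqrt 3 + 3) / 6.
Definition I3_right (R : realType) : R := (5 * Num.sqrt 3 - 3) / 6.
Definition I3 (R : realType) : interval R := `[I3_left R, I3_right R].

(* Q(x): the intersection of all subfields of R containing x.  Over a field,
   [divring_closed] (1, differences, quotients) characterizes subfields, and
   they all contain Q because R has characteristic 0. *)
Definition in_Q_adjoin (R : realType) (x y : R) : Prop :=
  forall K : {pred R}, divring_closed K -> x \in K -> y \in K.

(* Main.v *)
Require Import Defs.
From HB Require Import structures.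
From mathcomp Require Import all_boot all_order all_algebra.
From mathcomp Require Import reals.
From mathcomp Require Import ring lra zify.
Set Implicit Arguments.
Unset Strict Implicit.
Unset Printing Implicit Defensive.
Import Order.TTheory GRing.Theory Num.Theory.
Local Open Scope ring_scope.

(** Put [t = cn + d - a(n)] and [w = (1 + c)d - j/3], where [f(n) = 3a(n) - j] and
    [j] is 1, 2 or 3 according to the position of [t] relative to [c] and
    [2c - 1].  Since [3c = 1/c], one gets [a(f(n)) = n + k] with
    [k = floor((w - t)/c)], hence [a(a(f(n))) = a(n)] iff [0 <= t + ck < 1].  For
    [d] in [I3] this holds for every [t] in [[0, 1)], except for [t = c] at the
    right endpoint, which does not occur by irrationality of [sqrt 3].  For [d]
    outside [I3] it fails for an interval of values of [t], and [t] is dense in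
    [[0, 1)] when [n] runs over the integers [>= 3]. *)

Section Beatty.

Variable R : realType.
Local Notation s := (Num.sqrt 3 : R).

(** * Arithmetic of [sqrt 3] and density of [cn + d] modulo 1 *)

Lemma sqrt3_sqr : s * s = 3.
Proof. by rewrite -expr2 sqr_sqrtr. Qed.

Lemma sqrt3_bounds : 17 / 10 < s < 9 / 5.
Proof.
have s_ge0 : 0 <= s by rewrite sqrtr_ge0.
have := sqrt3_sqr => ss.
by apply/andP; split; nra.
Qed.

Lemma cE : c R = s / 3.
Proof.
have /andP[s_gt _] := sqrt3_bounds.
have s_neq0 : s != 0 by apply: lt0r_neq0; lra.
by apply: (mulfI s_neq0); rewrite /c div1r divff // mulrA sqrt3_sqr divff ?pnatr_eq0.
Qed.

Lemma floor_eqP (x : R) (m : int) :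
  m%:~R <= x -> x < m%:~R + 1 -> Num.floor x = m.
Proof. by move=> lo hi; apply: floor_def; rewrite lo intrD. Qed.

(** Powers of [2 - s], a unit of Z[sqrt 3] between 0 and 1/2, supply arbitrarily small positive
    integer combinations of 1 and [c]. *)
Lemma pow_2_sub_sqrt3 (k : nat) :
  exists p q : nat, (2 - s) ^+ k = p%:R - 3 * q%:R * c R.
Proof.
elim: k => [|k [p [q IH]]].
  by exists 1%N, 0%N; rewrite expr0; ring.
exists (2 * p + 3 * q)%N, (p + 2 * q)%N.
rewrite exprS IH cE.
have -> : (2 - s) * (p%:R - 3 * q%:R * (s / 3)) =
   2 * p%:R + (s * s) * q%:R - (p%:R + 2 * q%:R) * s by field.
by rewrite sqrt3_sqr; field.
Qed.

Lemma small_combination (e : R) : 0 < e ->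
  exists p q : nat, 0 < p%:R - q%:R * c R < e.
Proof.
move=> e_gt0; have /andP[s_gt s_lt] := sqrt3_bounds.
pose k := Num.bound e^-1.
have lt2k : e^-1 < 2 ^+ k by apply: upper_nthrootP.
have [p [q pq]] := pow_2_sub_sqrt3 k.
exists p, (3 * q)%N; rewrite natrM -pq exprn_gt0 /=; last by lra.
apply: (@le_lt_trans _ _ (2^-1 ^+ k)).
  by apply: lerXn2r; rewrite ?nnegrE; lra.
by rewrite exprVn invf_plt ?posrE // exprn_gt0.
Qed.

(* Steps of [q] in [n] move [c * n + d] down by the small positive number
   [p - q * c] modulo 1, hence cannot jump over the target interval. *)
Lemma frac_dense (d l r : R) : 0 <= l -> l < r -> r <= 1 ->
  exists n : int, 3 <= n /\ l <= c R * n%:~R + d - (a d n)%:~R < r.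
Proof.
move=> l_ge0 ltlr r_le1.
have [p [q /andP[e_gt0 e_lt]]] := @small_combination (r - l) ltac:(lra).
set e := _ - _ in e_gt0 e_lt.
(* Subtracting 1 gives [x - z >= 1 > l], which makes [m] nonnegative and hence [n >= 3]. *)
pose x := c R * 3 + d; pose z : int := Num.floor x - 1.
have zx : z%:~R + 1 <= x by rewrite intrD; have := floor_le x; lra.
pose m : int := Num.floor ((x - z%:~R - l) / e).
have m_le : m%:~R * e <= x - z%:~R - l.
  by rewrite -ler_pdivlMr // floor_le.
have m_gt : x - z%:~R - l < (m%:~R + 1) * e.
  by rewrite -ltr_pdivrMr // -[1]/(1%:~R) -intrD floorD1_gt.
have m_ge0 : 0 <= m by rewrite floor_ge0 divr_ge0 //; lra.
exists (3 + m * q%:Z); split; first by nia.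
have E : c R * (3 + m * q%:Z)%:~R + d
    = (z + m * p%:Z)%:~R + (x - z%:~R - m%:~R * e).
  by rewrite /e /x !intrD !intrM -!pmulrn; ring.
rewrite /a (@floor_eqP _ (z + m * p%:Z)) E; lra.
Qed.

(** * The iterate in terms of the fractional part [t] *)

Definition fracpart (d : R) (n : int) : R := c R * n%:~R + d - (a d n)%:~R.

Lemma fracpart_itv (d : R) (n : int) : 0 <= fracpart d n < 1.
Proof.
rewrite /fracpart /a; set x := _ + d.
have := floor_le x; have := floorD1_gt x; rewrite intrD => lo hi.
by apply/andP; split; lra.
Qed.

Lemma a_shift (d : R) (n k : int) :
  a d (n + k) = a d n + Num.floor (fracpart d n + c R * k%:~R).
Proof.
have xE : c R * (n + k)%:~R + d =
    fracpart d n + c R * k%:~R + (a d n)%:~R by rewrite /fracpart; ring.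
by rewrite {1}/a xE floorDrz ?intr_int // intrKfloor addrC.
Qed.

(** The bounds on [k] place [t + ck] in the window [(w - c, w]], to be compared with [[0, 1)]. *)
Lemma a_a_f_eqP (d : R) (n j : int) : f d n = 3 * a d n - j ->
  exists2 k : int,
    c R * k%:~R <= (1 + c R) * d - j%:~R / 3 - fracpart d n < c R * k%:~R + c R
    & a d (a d (f d n)) = a d n <-> 0 <= fracpart d n + c R * k%:~R < 1.
Proof.
move=> fE; have /andP[s_gt _] := sqrt3_bounds.
pose w := (1 + c R) * d - j%:~R / 3 - fracpart d n.
pose k := Num.floor (s * w); exists k; rewrite -?/w.
  have wE : w = c R * (s * w).
    rewrite cE [RHS](_ : _ = s * s / 3 * w); last by field.
    by rewrite sqrt3_sqr; field.
  have c_gt0 : 0 < c R by rewrite cE; lra.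
  rewrite wE ler_pM2l // floor_le /= -{3}[c R]mulr1 -mulrDr ltr_pM2l //.
  by rewrite -[1]/(1%:~R) -intrD floorD1_gt.
have -> : a d (f d n) = n + k.
  have xE : c R * (f d n)%:~R + d = s * w + n%:~R.
    rewrite fE /w /fracpart cE intrB intrM.
    rewrite [RHS](_ : _ = s * d + s * s / 3 * d - s * j%:~R / 3
      - s * s / 3 * n%:~R - s * d + s * (a d n)%:~R + n%:~R); last by field.
    by rewrite sqrt3_sqr; field.
  by rewrite {1}/a xE floorDrz ?intr_int // intrKfloor addrC.
rewrite a_shift; set v := _ + c R * _; split=> [vE|/andP[v_ge0 v_lt1]].
  have := floor_le v; have := floorD1_gt v; rewrite intrD.
  have -> : Num.floor v = 0 by lia.
  by move=> hi lo; apply/andP; split; lra.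
by rewrite (@floor_eqP _ 0) ?addr0 ?add0r.
Qed.

(** In this and the next two lemmas, [floor(t - c)] is 0 or -1 according to whether [t >= c], and
    [floor(t - 2c)] is -1 or -2 according to whether [t >= 2c - 1]. *)
Lemma f_fracpart_ge (d : R) (n : int) :
  c R <= fracpart d n -> f d n = 3 * a d n - 1.
Proof.
have /andP[s_gt s_lt] := sqrt3_bounds; have /andP[t_ge0 t_lt1] := fracpart_itv d n.
rewrite /f !a_shift cE => c_le.
by rewrite (@floor_eqP _ 0) 1?(@floor_eqP _ (-1)); first ring; lra.
Qed.

Lemma f_fracpart_mid (d : R) (n : int) :
  2 * c R - 1 <= fracpart d n -> fracpart d n < c R -> f d n = 3 * a d n - 2.
Proof.
have /andP[s_gt s_lt] := sqrt3_bounds; have /andP[t_ge0 t_lt1] := fracpart_itv d n.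
rewrite /f !a_shift cE => c_le lt_c.
by rewrite (@floor_eqP _ (-1)) 1?(@floor_eqP _ (-1)); first ring; lra.
Qed.

Lemma f_fracpart_lt (d : R) (n : int) :
  fracpart d n < 2 * c R - 1 -> f d n = 3 * a d n - 3.
Proof.
have /andP[s_gt s_lt] := sqrt3_bounds; have /andP[t_ge0 t_lt1] := fracpart_itv d n.
rewrite /f !a_shift cE => lt_c.
by rewrite (@floor_eqP _ (-1)) 1?(@floor_eqP _ (-2)); first ring; lra.
Qed.

(* At the right endpoint of [I3], [fracpart = c] would give
   [(2n+3)^2 = 3(2m+1)^2], which is impossible modulo 4. *)
Lemma fracpart_neq_c (n : int) : fracpart (I3_right R) n != c R.
Proof.
apply/eqP; rewrite /fracpart /I3_right cE; set m := a _ n => cEq.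
have sE : s * (2 * n + 3)%:~R = 3 * (2 * m + 1)%:~R.
  by rewrite !intrD !intrM; lra.
have sqE : ((2 * n + 3) ^+ 2)%:~R = (3 * (2 * m + 1) ^+ 2)%:~R :> R.
  apply: (@mulfI _ 3); first by rewrite pnatr_eq0.
  rewrite -{1}sqrt3_sqr [LHS](_ : _ = (s * (2 * n + 3)%:~R) ^+ 2); last by ring.
  by rewrite sE; ring.
by move/eqP: sqE; rewrite eqr_int => /eqP; nia.
Qed.

(** * Sufficiency and necessity of the interval *)

Lemma sqrt3_expand (d : R) : (1 + c R) * d = d + s * d / 3.
Proof. by rewrite cE; ring. Qed.

Lemma iterate_eq_of_mem (d : R) (n : int) :
  d \in I3 R -> a d (a d (f d n)) = a d n.
Proof.
have /andP[s_gt s_lt] := sqrt3_bounds; have ss := sqrt3_sqr.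
have /andP[t_ge0 t_lt1] := fracpart_itv d n.
rewrite in_itv /= /I3_left /I3_right => /andP[d_ge d_le].
have E_ge : (2 + s) / 3 <= (1 + c R) * d by rewrite sqrt3_expand; nra.
have E_le : (1 + c R) * d <= (2 * s + 1) / 3 by rewrite sqrt3_expand; nra.
have t_neq : (1 + c R) * d = (2 * s + 1) / 3 -> fracpart d n != c R.
  move=> dE; suff -> : d = I3_right R by exact: fracpart_neq_c.
  by rewrite /I3_right; move: dE; rewrite sqrt3_expand; nra.
have c_gt0 : 0 < c R by rewrite cE; lra.
have [c_le|lt_c] := leP (c R) (fracpart d n).
  have [k /andP[lo hi] ->] := a_a_f_eqP (f_fracpart_ge c_le).
  (* Here [w <= 2c] and [t >= c], so [w - t <= c]; equality would need [t = c] at the right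
     endpoint, which [t_neq] excludes. *)
  have k_le0 : k <= 0.
    rewrite -ltzD1 -(ltr_int R) -(ltr_pM2l c_gt0); apply: le_lt_trans lo _.
    rewrite mulr1; have [/t_neq t_neqc|E_neq] := eqVneq ((1 + c R) * d) ((2 * s + 1) / 3).
      have : c R < fracpart d n by rewrite lt_neqAle eq_sym t_neqc.
      by move: c_le; rewrite cE in E_le *; lra.
    have : (1 + c R) * d < (2 * s + 1) / 3 by rewrite lt_neqAle E_neq.
    by rewrite cE in c_le *; lra.
  have : c R * k%:~R <= 0 by rewrite pmulr_rle0 // lerz0.
  by rewrite cE in lo hi E_ge *; move=> ?; apply/andP; split; lra.
have [c2_le|lt_c2] := leP (2 * c R - 1) (fracpart d n).
  have [k /andP[lo hi] ->] := a_a_f_eqP (f_fracpart_mid c2_le lt_c).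
  (* Now [c <= w <= 2c - 1/3], so the window lies in [[0, 1)] whatever [k] is. *)
  by rewrite cE in lo hi E_ge E_le *; apply/andP; split; lra.
have [k /andP[lo hi] ->] := a_a_f_eqP (f_fracpart_lt lt_c2).
(* Here [0 < w - t < c]. *)
suff -> : k = 0 by rewrite mulr0 addr0 t_ge0.
apply/le_anti/andP; split; rewrite -ltzD1 -(ltr_int R) -(ltr_pM2l c_gt0).
  by rewrite mulr1; apply: le_lt_trans lo _; rewrite cE in E_le *; lra.
by rewrite intrD mulrDr mulr0 mulr1; rewrite cE in lo hi lt_c2 E_ge *; lra.
Qed.

(** If [d] is too small, then [w < c] for [j = 2]; any [t] of the middle range above [w] gives
    [k <= -1], so [t + ck <= t - c < 0]. *)
Lemma left_le_of_iterate_eq (d : R) :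
  (forall n : int, 3 <= n -> a d (a d (f d n)) = a d n) -> I3_left R <= d.
Proof.
have /andP[s_gt s_lt] := sqrt3_bounds; have ss := sqrt3_sqr.
have c_gt0 : 0 < c R by rewrite cE; lra.
move=> aafE; rewrite leNgt /I3_left; apply/negP => d_lt.
have E_lt : (1 + c R) * d < (2 + s) / 3 by rewrite sqrt3_expand; nra.
pose w := (1 + c R) * d - 2 / 3.
(* [l] is the larger of [2c - 1] and the midpoint of [w] and [c]. *)
have [l [w_lt [c2_le l_lt]]] : exists l, w < l /\ 2 * c R - 1 <= l /\ l < c R.
  have [le_mid|lt_mid] := leP (2 * c R - 1) ((w + c R) / 2).
    by exists ((w + c R) / 2); move: E_lt le_mid; rewrite /w cE; do ?split; lra.
  exists (2 * c R - 1); move: lt_mid; rewrite /w cE; do ?split; lra.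
have [n [n_ge3]] : exists n : int, 3 <= n /\ l <= fracpart d n < c R.
  by apply: frac_dense => //; rewrite cE in c2_le *; lra.
move=> /andP[t_ge t_lt].
have [k /andP[lo _] [aaf_itv _]] :=
  a_a_f_eqP (f_fracpart_mid (le_trans c2_le t_ge) t_lt).
have /andP[v_ge0 _] := aaf_itv (aafE n n_ge3).
have k_le : k + 1 <= 0.
  rewrite lezD1 -(ltrz0 R) -(pmulr_rlt0 _ c_gt0).
  by apply: le_lt_trans lo _; rewrite -/w; lra.
have : c R * (k + 1)%:~R <= 0 by rewrite pmulr_rle0 // lerz0.
by rewrite intrD mulrDr mulr1; lra.
Qed.

(** If [d] is too large, then [w > 2c] for [j = 1]; any [t >= c] below [w - c] gives [k >= 1], so
    [t + ck >= 2c > 1]. *)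
Lemma le_right_of_iterate_eq (d : R) :
  (forall n : int, 3 <= n -> a d (a d (f d n)) = a d n) -> d <= I3_right R.
Proof.
have /andP[s_gt s_lt] := sqrt3_bounds; have ss := sqrt3_sqr.
have c_gt0 : 0 < c R by rewrite cE; lra.
move=> aafE; rewrite leNgt /I3_right; apply/negP => d_gt.
have E_gt : (2 * s + 1) / 3 < (1 + c R) * d by rewrite sqrt3_expand; nra.
pose w := (1 + c R) * d - 1 / 3.
have [r [r_le [r_le1 r_gt]]] : exists r, r <= w - c R /\ r <= 1 /\ c R < r.
  have [le_1|lt_1] := leP (w - c R) 1.
    by exists (w - c R); move: E_gt le_1; rewrite /w cE; do ?split; lra.
  by exists 1; move: lt_1; rewrite /w cE; do ?split; lra.
have [n [n_ge3 /andP[t_ge t_lt]]] :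
    exists n : int, 3 <= n /\ c R <= fracpart d n < r.
  by apply: frac_dense => //; apply: ltW.
have [k /andP[_ hi] [aaf_itv _]] := a_a_f_eqP (f_fracpart_ge t_ge).
have /andP[_ v_lt1] := aaf_itv (aafE n n_ge3).
have k_gt0 : 0 < k.
  rewrite -(ltr0z R) -(pmulr_rgt0 _ c_gt0).
  by move: hi; rewrite -[1%:~R]/1 -/w; lra.
have : c R * 1 <= c R * k%:~R by rewrite ler_pM2l // -[1]/(1%:~R) ler_int.
by rewrite cE in t_ge v_lt1 *; lra.
Qed.

(** * Endpoints in Q(sqrt 3) *)

Lemma divring_closed_nat (K : {pred R}) (n : nat) : divring_closed K -> n%:R \in K.
Proof.
move=> [K1 KB _]; have K0 : 0 \in K by rewrite -(subrr 1) KB.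
elim: n => // n IHn.
by have := KB _ _ IHn (KB _ _ K0 K1); rewrite sub0r opprK natr1.
Qed.

Lemma Q_adjoin_affine (m n k : nat) (b : bool) (x : R) :
  in_Q_adjoin x ((m%:R * x + (-1) ^+ b * n%:R) / k%:R).
Proof.
move=> K K_closed Kx; have [K1 KB Kdiv] := K_closed.
have Kn i := @divring_closed_nat K i K_closed.
have KN y : y \in K -> - y \in K by move=> Ky; rewrite -sub0r KB // (Kn 0%N).
(* Products come from quotients as [y / (1 / z)]; the convention [0^-1 = 0] covers [z = 0]. *)
have KM y z : y \in K -> z \in K -> y * z \in K.
  by move=> Ky Kz; rewrite -[z]invrK Kdiv // -[_^-1]mul1r Kdiv.
apply: Kdiv => //; rewrite -[_ * n%:R]opprK KB ?KM ?KN //.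
by case: b; rewrite ?expr0 ?expr1 ?mulN1r ?mul1r ?opprK ?KN.
Qed.

End Beatty.

Theorem theorem4p6 (R : realType) :
  (forall d : R,
     (forall n : int, 3 <= n -> a d (a d (f d n)) = a d n) <-> d \in I3 R) /\
  (I3_left R + I3_right R) / 2 = Num.sqrt 3 / 2 /\
  (I3_right R - I3_left R) / 2 = (2 * Num.sqrt 3 - 3) / 6 /\
  in_Q_adjoin (Num.sqrt 3) (I3_left R) /\
  in_Q_adjoin (Num.sqrt 3) (I3_right R).
Proof.
split.
  move=> d; split=> [aafE|d_in n _]; last exact: iterate_eq_of_mem.
  by rewrite in_itv /= left_le_of_iterate_eq ?le_right_of_iterate_eq.
split; first by rewrite /I3_left /I3_right; field.
split; first by rewrite /I3_left /I3_right; field.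
split.
  rewrite (_ : I3_left R = (1%:R * Num.sqrt 3 + (-1) ^+ false * 3%:R) / 6%:R).
    exact: Q_adjoin_affine.
  by rewrite /I3_left expr0 !mul1r.
rewrite (_ : I3_right R = (5%:R * Num.sqrt 3 + (-1) ^+ true * 3%:R) / 6%:R).
  exact: Q_adjoin_affine.
by rewrite /I3_right expr1 mulN1r.
Qed.
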